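(* Suppose we are given as input: (1) a finite symmetric set $X$ of bounded automaton automorphisms of the tree $\mathcal T_d=C^*$, where $C=\{c_1,\dots,c_d\}$, $d\ge2$; (2) a word $w\in X^*$ over the generating set $X$; and (3) a Turing machine $T$ which outputs an infinite ray $\eta\in C^\omega$. Then, given the promise that $T$ does not generate an eventually periodic ray, it is computationally decidable whether $w\in\mathrm{WP}(\langle X\rangle,X,\mathrm{Stab}(\eta))$. That is, membership to $\mathrm{WP}(\langle X\rangle,X,\mathrm{Stab}(\eta))$ is decidable as a promise problem uniformly for all bounded automata groups and uniformly for all non-eventually-periodic computable rays.
   Context: The vertices of the $d$-regular rooted tree $\mathcal T_d$ are the words in $C^*$; the root is the empty word and the children of $v$ are $vc_1,\dots,vc_d$. $\mathrm{Aut}(\mathcal T_d)$ is the group of rooted-tree automorphisms, acting on the right; the action extends to infinite rays (infinite words) in $C^\omega$. For $\alpha\in\mathrm{Aut}(\mathcal T_d)$ and $v\in C^*$, the section $\alpha@v$ is the unique automorphism with $(vu)\cdot\alpha=(v\cdot\alpha)(u\cdot(\alpha@v))$ for all $u\in C^*$. An automorphism $\alpha$ is an automaton automorphism if $\{\alpha@v:v\in C^*\}$ is finite; such an automorphism is determined by finite data (a finite automaton whose states are its sections) and is given as input in this form. It is a bounded automaton automorphism if moreover there is a constant $N_\alpha$ with $\#\{v\in C^*:\alpha@v\ne1,\ |v|=k\}<N_\alpha$ for every positive integer $k$. A bounded automata group is a group of bounded automaton automorphisms. For $G=\langle X\rangle$ and $\eta\in C^\omega$, $\mathrm{Stab}(\eta)=\{g\in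 G:\eta\cdot g=\eta\}$. For $w\in X^*$, $\overline w\in G$ is the product of its letters, and $\mathrm{WP}(G,X,H)=\{w\in X^*:\overline w\in H\}$ for a subgroup $H\le G$. A ray is eventually periodic if it has the form $ab^\omega$ with $a,b\in C^*$, $b\neq\varepsilon$. A Turing machine outputs a ray if it successively writes all the letters of the infinite word. Decidable as a promise problem means: there is an algorithm which halts with the correct answer on every input satisfying the promise, with no requirement on other inputs. *)

(* Defs.v *)
From HB Require Import structures.
From mathcomp Require Import all_boot.
From mathcomp Require Import boolp classical_sets cardinality.

Set Implicit Arguments.
Unset Strict Implicit.
Unset Printing Implicit Defensive.

Local Open Scope classical_set_scope.

(* Automorphisms of the d-regular rooted tree.  The alphabet C is 'I_d, the  *)
(* vertices are the words over it, and the empty word is the root.           *)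

Definition child d (u v : seq 'I_d) : bool := [exists c, v == rcons u c].

(* The parent-child relation is directed away from the root, so preserving   *)
(* it forces the root to be fixed (taut_root below).  The inverse is carried *)
(* along; it is determined by the function (taut_inj).                       *)
Record taut d := Taut {
  taut_fun :> seq 'I_d -> seq 'I_d;
  taut_inv : seq 'I_d -> seq 'I_d;
  taut_funK : cancel taut_fun taut_inv;
  taut_invK : cancel taut_inv taut_fun;
  taut_child : forall u v, child (taut_fun u) (taut_fun v) = child u v
}.

Section Taut.
Variable d : nat.
Implicit Types (a b : taut d) (u v : seq 'I_d).

Lemma taut_inj a b : taut_fun a =1 taut_fun b -> a = b.
Proof.
case: a b => f f' fK f'K fc [g g' gK g'K gc] /= /funext fg.
have f'g' : f' = g' by apply: funext => u; rewrite -[in LHS](g'K u) -fg fK.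
case: _ / fg gK g'K gc => gK g'K gc; case: _ / f'g' gK g'K => gK g'K.
by congr Taut; exact: Prop_irrelevance.
Qed.

Lemma taut_inv_child a u v : child (taut_inv a u) (taut_inv a v) = child u v.
Proof. by rewrite -(taut_child a) !taut_invK. Qed.

Definition taut_one : taut d :=
  @Taut d id id (frefl _) (frefl _) (fun _ _ => erefl).

Definition taut_opp a : taut d :=
  Taut (@taut_invK d a) (@taut_funK d a) (@taut_inv_child a).

Lemma taut_mul_child a b u v : child (b (a u)) (b (a v)) = child u v.
Proof. by rewrite !taut_child. Qed.

(* Automorphisms act on the right: v . (a * b) = (v . a) . b, where v . a is *)
(* written a v.                                                              *)
Definition taut_mul a b : taut d :=
  @Taut d (fun v => b (a v)) (fun v => taut_inv a (taut_inv b v))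
    (can_comp (@taut_funK d b) (@taut_funK d a))
    (can_comp (@taut_invK d a) (@taut_invK d b)) (@taut_mul_child a b).

End Taut.

HB.instance Definition _ d := gen_eqMixin (taut d).
HB.instance Definition _ d := gen_choiceMixin (taut d).

Lemma taut_mulA d : associative (@taut_mul d).
Proof. by move=> a b c; apply: taut_inj. Qed.

Lemma taut_mul1g d : left_id (taut_one d) (@taut_mul d).
Proof. by move=> a; apply: taut_inj. Qed.

Lemma taut_mulg1 d : right_id (taut_one d) (@taut_mul d).
Proof. by move=> a; apply: taut_inj. Qed.

Lemma taut_mulVg d : left_inverse (taut_one d) (@taut_opp d) (@taut_mul d).
Proof. by move=> a; apply: taut_inj => v; exact: taut_invK. Qed.

Lemma taut_mulgV d : right_inverse (taut_one d) (@taut_opp d) (@taut_mul d).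
Proof. by move=> a; apply: taut_inj => v; exact: taut_funK. Qed.

HB.instance Definition _ d := isGroup.Build (taut d)
  (@taut_mulA d) (@taut_mul1g d) (@taut_mulg1 d) (@taut_mulVg d)
  (@taut_mulgV d).


Section Sections.
Variable d : nat.
Implicit Types (a b : taut d) (u v : seq 'I_d).

Lemma childP u v : reflect (exists c, v = rcons u c) (child u v).
Proof. exact: 'exists_eqP. Qed.

Lemma child_rcons v c : child v (rcons v c).
Proof. by apply/childP; exists c. Qed.

Lemma taut_root a : a [::] = [::].
Proof.
case/lastP e: (a [::]) => [//|s c].
have := taut_inv_child a s (a [::]).
rewrite taut_funK e child_rcons => /childP[c']; by case: (taut_inv a s).
Qed.

Lemma taut_rcons a v c : exists c', a (rcons v c) = rcons (a v) c'.
Proof. by apply/childP; rewrite taut_child child_rcons. Qed.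

Lemma size_taut a v : size (a v) = size v.
Proof.
elim/last_ind: v => [|v c IH]; first by rewrite taut_root.
by have [c' ->] := taut_rcons a v c; rewrite !size_rcons IH.
Qed.

Lemma taut_prefix a v u : a v ++ drop (size v) (a (v ++ u)) = a (v ++ u).
Proof.
elim/last_ind: u => [|u c IH].
  by rewrite cats0 drop_oversize ?size_taut// cats0.
rewrite -rcons_cat; have [c' ->] := taut_rcons a (v ++ u) c.
by rewrite drop_rcons ?size_taut ?size_cat ?leq_addr// -rcons_cat IH.
Qed.

Definition section_fun a v u := drop (size v) (a (v ++ u)).

Lemma section_funE a v u : a (v ++ u) = a v ++ section_fun a v u.
Proof. by rewrite taut_prefix. Qed.

Lemma section_funK a v :
  cancel (section_fun a v) (section_fun (taut_opp a) (a v)).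
Proof.
move=> u; rewrite /section_fun taut_prefix /= taut_funK size_taut.
by rewrite drop_size_cat.
Qed.

Lemma section_invK a v :
  cancel (section_fun (taut_opp a) (a v)) (section_fun a v).
Proof.
move=> u; have := section_funK (taut_opp a) (a v) u.
suff -> : taut_opp (taut_opp a) = a by rewrite /= taut_funK.
exact: taut_inj.
Qed.

Lemma child_cat v u u' : child (v ++ u) (v ++ u') = child u u'.
Proof.
apply/childP/childP => -[c e]; exists c; last by rewrite e rcons_cat.
by move/eqP: e; rewrite rcons_cat eqseq_cat// eqxx => /eqP.
Qed.

Lemma section_child a v u u' :
  child (section_fun a v u) (section_fun a v u') = child u u'.
Proof. by rewrite -(child_cat (a v)) -!section_funE taut_child child_cat. Qed.

(* section a v is the section a@v; it is characterized by sectionE and       *)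
(* section_unique.                                                           *)
Definition section a v : taut d :=
  Taut (@section_funK a v) (@section_invK a v) (@section_child a v).

Lemma sectionE a v u : a (v ++ u) = a v ++ section a v u.
Proof. exact: section_funE. Qed.

Lemma section_unique a v b :
  (forall u, a (v ++ u) = a v ++ b u) -> b = section a v.
Proof.
move=> avb; apply: taut_inj => u /=.
by rewrite /section_fun avb -(size_taut a v) drop_size_cat.
Qed.

End Sections.


Definition automaton_aut d (a : taut d) : Prop :=
  finite_set (range (section a)).

Definition bounded_automaton_aut d (a : taut d) : Prop :=
  automaton_aut a /\
  exists N, forall k, 0 < k ->
    #|[set v : k.-tuple 'I_d | section a v != 1%g]%SET| < N.

Definition symmetric_set d (X : set (taut d)) : Prop :=
  forall a, X a -> X a^-1%g.

Definition is_subgroup d (H : set (taut d)) : Prop :=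
  [/\ H 1%g, (forall a b, H a -> H b -> H (a * b)%g) &
      forall a, H a -> H a^-1%g].

Definition generated d (X : set (taut d)) : set (taut d) :=
  smallest (@is_subgroup d) X.

Definition ray d := nat -> 'I_d.

(* The n-th letter of eta . a is the last letter of (eta_0 ... eta_n) . a.   *)
Definition ray_act d (eta : ray d) (a : taut d) : ray d :=
  fun n => nth (eta 0) (a (mkseq eta n.+1)) n.

Definition Stab d (X : set (taut d)) (eta : ray d) : set (taut d) :=
  [set g | generated X g /\ ray_act eta g = eta].

Definition WP d (X H : set (taut d)) : set (seq (taut d)) :=
  [set w | [set` w] `<=` X /\ H (\big[*%g/1%g]_(g <- w) g)].

Definition eventually_periodic d (eta : ray d) : Prop :=
  exists a b : seq 'I_d, b != [::] /\
    forall n, eta n = if n < size a then nth (eta 0) a n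
                      else nth (eta 0) b ((n - size a) %% size b).


Record automaton d := Automaton {
  aut_size : nat;
  aut_init : 'I_aut_size;
  aut_delta : {ffun 'I_aut_size -> {ffun 'I_d -> 'I_d * 'I_aut_size}}
}.

(* aut_delta q c = (output letter, next state). *)
Fixpoint aut_run d (A : automaton d) (q : 'I_(aut_size A)) (v : seq 'I_d) :=
  if v is c :: v' then
    (aut_delta A q c).1 :: aut_run (aut_delta A q c).2 v'
  else [::].

(* A need not be minimal: two states may define the same section.            *)
Definition presents d (A : automaton d) (a : taut d) : Prop :=
  forall v, a v = aut_run (aut_init A) v.

(* Turing machines started on a blank two-way infinite tape, which may, at   *)
(* each step, append one letter of 'I_d to a write-only output.              *)

Inductive move := MLeft | MStay | MRight.

(* State 0 is initial and symbol 0 is the blank; tm_delta q s = None halts. *)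
Record tm d := TM {
  tm_states : nat;
  tm_syms : nat;
  tm_delta : {ffun 'I_tm_states.+1 -> {ffun 'I_tm_syms.+1 ->
    option ('I_tm_states.+1 * 'I_tm_syms.+1 * move * option 'I_d)}}
}.

(* cfg_left lists the symbols to the left of the head, nearest first;        *)
(* cfg_right starts with the scanned symbol.  Both continue with blanks.     *)
Record config d (T : tm d) := Config {
  cfg_state : 'I_(tm_states T).+1;
  cfg_left : seq 'I_(tm_syms T).+1;
  cfg_right : seq 'I_(tm_syms T).+1;
  cfg_out : seq 'I_d
}.

Definition tm_init d (T : tm d) : config T :=
  Config (T := T) ord0 [::] [::] [::].

Definition tm_step d (T : tm d) (c : config T) : config T :=
  let: Config q l r o := c in
  if tm_delta T q (head ord0 r) is Some (q', s, m, x) then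
    let r' := s :: behead r in
    let o' := if x is Some y then rcons o y else o in
    match m with
    | MLeft => Config (T := T) q' (behead l) (head ord0 l :: r') o'
    | MStay => Config (T := T) q' l r' o'
    | MRight => Config (T := T) q' (s :: l) (behead r) o'
    end
  else c.

Definition tm_outputs d (T : tm d) (eta : ray d) : Prop :=
  forall n, exists t,
    prefix (mkseq eta n) (cfg_out (iter t (@tm_step d T) (tm_init T))).

(* CodeSeq.code is a bijection from seq nat to nat, and every table below is *)
(* listed in the enumeration order of its (ordinal) index types, so that the *)
(* input can be recovered from its code.                                     *)
Section Encoding.
Variable d : nat.

Definition code_list T (f : T -> nat) (s : seq T) : nat :=
  CodeSeq.code (map f s).

Definition code_automaton (A : automaton d) : nat :=
  CodeSeq.code [:: nat_of_ord (aut_init A);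
    code_list
      (fun row : {ffun 'I_d -> 'I_d * 'I_(aut_size A)} =>
         code_list (fun p : 'I_d * 'I_(aut_size A) =>
                      CodeSeq.code [:: nat_of_ord p.1; nat_of_ord p.2])
                   (codom row))
      (codom (aut_delta A))].

Definition code_move (m : move) : nat :=
  match m with MLeft => 0 | MStay => 1 | MRight => 2 end.

Definition code_action n k (x : option ('I_n * 'I_k * move * option 'I_d)) :=
  if x is Some (q, s, m, o) then
    CodeSeq.code [:: nat_of_ord q; nat_of_ord s; code_move m;
                     if o is Some c then (nat_of_ord c).+1 else 0]
  else CodeSeq.code [::].

Definition code_tm (T : tm d) : nat :=
  code_list (fun row : {ffun _ -> _} =>
               code_list (@code_action _ _) (codom row))
            (codom (tm_delta T)).

Definition code_instance m (A : m.-tuple (automaton d)) (w : seq 'I_m)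
    (T : tm d) : nat :=
  CodeSeq.code [:: d; code_list code_automaton A;
                   code_list (@nat_of_ord m) w; code_tm T].

End Encoding.

(* The model of computation: Kleene's partial recursive functions.           *)
Inductive recfun : nat -> Type :=
| RZero k : recfun k
| RSucc : recfun 1
| RProj k (i : 'I_k) : recfun k
| RComp k m (f : recfun m) (g : 'I_m -> recfun k) : recfun k
| RPrec k (f : recfun k) (g : recfun k.+2) : recfun k.+1
| RMin k (f : recfun k.+1) : recfun k.

(* recfun_graph f v y: f halts on the arguments v with value y.  The         *)
(* recursion (resp. minimization) variable is the first argument.            *)
Fixpoint recfun_graph k (f : recfun k) : k.-tuple nat -> nat -> Prop :=
  match f in recfun k return k.-tuple nat -> nat -> Prop with
  | RZero _ => fun _ y => y = 0
  | RSucc => fun v y => y = (thead v).+1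
  | RProj _ i => fun v y => y = tnth v i
  | RComp _ m f g => fun v y =>
      exists2 u : m.-tuple nat,
        forall i, recfun_graph (g i) v (tnth u i) & recfun_graph f u y
  | RPrec _ f g => fun v y =>
      let v' := [tuple of behead v] in
      exists h : nat -> nat,
        [/\ recfun_graph f v' (h 0),
            forall j, j < thead v ->
              recfun_graph g [tuple of j :: h j :: v'] (h j.+1) &
            y = h (thead v)]
  | RMin _ f => fun v y =>
      recfun_graph f [tuple of y :: v] 0 /\
      forall z, z < y ->
        exists x, recfun_graph f [tuple of z :: v] x.+1
  end.

Lemma recfun_graph_fun k (f : recfun k) v y y' :
  recfun_graph f v y -> recfun_graph f v y' -> y = y'.
Proof.
elim: f v y y' => {k} /=.
- by move=> k v y y' -> ->.
- by move=> v y y' -> ->.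
- by move=> k i v y y' -> ->.
- move=> k m f IHf g IHg v y y' [u gu fu] [u' gu' fu'].
  suff uu' : u = u' by apply: IHf fu _; rewrite uu'.
  by apply: eq_from_tnth => i; exact: IHg (gu i) (gu' i).
- move=> k f IHf g IHg v y y' [h [h0 hS ->]] [h' [h'0 h'S ->]].
  suff: forall j, j <= thead v -> h j = h' j by apply.
  elim=> [_|j IHj lt_jv]; first exact: IHf h0 h'0.
  have := h'S _ lt_jv; rewrite -IHj 1?ltnW// => hj'.
  exact: IHg (hS _ lt_jv) hj'.
- move=> k f IHf v y y' [fy0 fy] [fy'0 fy'].
  have [lt|lt|//] := ltngtP y y'.
  + by have [x fx] := fy' _ lt; have := IHf _ _ _ fy0 fx.
  + by have [x fx] := fy _ lt; have := IHf _ _ _ fy'0 fx.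
Qed.

(* On input n, D halts with the correct truth value of P.                    *)
Definition answers (D : recfun 1) (n : nat) (P : Prop) : Prop :=
  (P -> recfun_graph D [tuple n] 1) /\ (~ P -> recfun_graph D [tuple n] 0).

(* Main.v *)
(* Let g be the product of the letters of w.  If g fixes eta and no section of g
   along eta is trivial, then some nontrivial section s occurs infinitely often
   along eta.  The words leading from s back to s commute pairwise, since two
   non-commuting ones would produce exponentially many vertices with nontrivial
   section, and this makes eta eventually periodic.  Under the promise, the
   membership of w therefore has a finite certificate: either g moves some
   computed prefix of eta, or g fixes such a prefix and the section of g there
   lies in a finite set of states of the product automaton that is closed under
   transitions and whose states all act trivially on letters.  An unbounded
   search finds one of the two. *)
Require Import Defs.
From mathcomp Require Import all_boot.
From mathcomp Require Import boolp classical_sets cardinality.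

Set Implicit Arguments.
Unset Strict Implicit.
Unset Printing Implicit Defensive.

(** * Partial recursive functions *)

Definition recursive k (f : k.-tuple nat -> nat) : Prop :=
  exists r : recfun k, forall v, recfun_graph r v (f v).

Definition recursive1 (F : nat -> nat) :=
  recursive (fun v : 1.-tuple nat => F (tnth v ord0)).
Definition recursive2 (F : nat -> nat -> nat) :=
  recursive (fun v : 2.-tuple nat => F (tnth v ord0) (tnth v (inord 1))).

Section Recursive.
Variable k : nat.
Implicit Types f g : k.-tuple nat -> nat.

Lemma recursive_proj (i : 'I_k) : recursive (fun v => tnth v i).
Proof. by exists (RProj i). Qed.

Lemma recursive_comp m (F : m.-tuple nat -> nat) (g : 'I_m -> k.-tuple nat -> nat) :
  recursive F -> (forall i, recursive (g i)) ->
  recursive (fun v => F [tuple g i v | i < m]).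
Proof.
move=> [r rF] /choice[s sg]; exists (RComp r s) => v /=.
by exists [tuple g i v | i < m] => // i; rewrite tnth_mktuple.
Qed.

Lemma recursive_app1 (F : nat -> nat) f :
  recursive1 F -> recursive f ->
  recursive (fun v => F (f v)).
Proof.
move=> rF rf; have := recursive_comp (g := fun=> f) rF (fun=> rf).
by congr recursive; apply: funext => v; rewrite tnth_mktuple.
Qed.

Lemma recursive_app2 (F : nat -> nat -> nat) f g :
  recursive2 F ->
  recursive f -> recursive g -> recursive (fun v => F (f v) (g v)).
Proof.
move=> rF rf rg.
have rfg (i : 'I_2) : recursive (if i == ord0 then f else g) by case: ifP.
have := recursive_comp rF rfg; congr recursive; apply: funext => v.
by rewrite !tnth_mktuple eqxx -val_eqE /= inordK.
Qed.

Lemma recursive_prec f (g : k.+2.-tuple nat -> nat) :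
  recursive f -> recursive g ->
  recursive (fun v : k.+1.-tuple nat =>
    iteri (thead v) (fun j y => g [tuple of j :: y :: behead v])
      (f [tuple of behead v])).
Proof.
move=> [r rf] [s sg]; exists (RPrec r s) => v /=.
exists (fun n => iteri n (fun j y => g [tuple of j :: y :: behead v])
      (f [tuple of behead v])); split=> // j _ /=; exact: sg.
Qed.

Lemma recursive_min (F : nat -> k.-tuple nat -> nat) (M : k.-tuple nat -> nat) :
  recursive (fun v : k.+1.-tuple nat => F (thead v) [tuple of behead v]) ->
  (forall v, F (M v) v = 0) -> (forall v z, z < M v -> F z v != 0) ->
  recursive M.
Proof.
move=> [r rF] M0 Mlt; exists (RMin r) => v /=.
have E z : recfun_graph r [tuple of z :: v] (F z v).
  have := rF [tuple of z :: v]; rewrite theadE.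
  by congr (recfun_graph r _ (F z _)); apply: val_inj.
split=> [|z /Mlt nz]; first by rewrite -[X in recfun_graph _ _ X](M0 v).
by exists (F z v).-1; rewrite prednK ?lt0n.
Qed.

Lemma recursive_const c : recursive (fun _ : k.-tuple nat => c).
Proof.
elim: c => [|c IH]; first by exists (RZero k).
by apply: (recursive_app1 (F := succn)) IH; exists RSucc.
Qed.

End Recursive.

Lemma recursive1_id : recursive1 id.
Proof. exact: recursive_proj. Qed.

Lemma recursive2_fst : recursive2 (fun x _ => x).
Proof. exact: recursive_proj. Qed.

Lemma recursive2_snd : recursive2 (fun _ y => y).
Proof. exact: recursive_proj. Qed.

Lemma recursive1_succ : recursive1 succn.
Proof. by exists RSucc. Qed.

Lemma recursive1_pred : recursive1 predn.
Proof.
(* The recursion has base value [0], and its step returns the counter. *)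
have := recursive_prec (recursive_const 0 0) (recursive_proj (ord0 : 'I_2)).
by congr recursive; apply: funext => v; rewrite -/(thead v); case: (thead v).
Qed.

Lemma recursive2_iter (F : nat -> nat) :
  recursive1 F -> recursive2 (fun n x => iter n F x).
Proof.
move=> rF.
have := recursive_prec (recursive_proj (ord0 : 'I_1))
  (recursive_app1 rF (recursive_proj (inord 1 : 'I_3))).
congr recursive; apply: funext => v; rewrite -/(thead v).
have -> : tnth [tuple of behead v] ord0 = tnth v (inord 1).
  by rewrite !(tnth_nth 0) nth_behead inordK.
elim: (thead v) => //= n ->.
by congr F; rewrite (tnth_nth 0) inordK.
Qed.

Lemma recursive2_sub : recursive2 subn.
Proof.
have := recursive_app2 (recursive2_iter recursive1_pred) recursive2_snd
  recursive2_fst.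
congr recursive; apply: funext => v.
by elim: (tnth v (inord 1)) => [|n IH]; rewrite ?subn0//= IH subnS.
Qed.

Lemma recursive2_add : recursive2 addn.
Proof.
have := recursive2_iter recursive1_succ.
by congr recursive; apply: funext => v; rewrite iter_succn addnC.
Qed.

Lemma recursive2_mul : recursive2 muln.
Proof.
have := recursive_prec (recursive_const 1 0)
  (recursive_app2 recursive2_add (recursive_proj (inord 1 : 'I_3))
     (recursive_proj (inord 2 : 'I_3))).
congr recursive; apply: funext => v; rewrite -/(thead v).
elim: (thead v) => //= n ->.
by rewrite !(tnth_nth 0) !inordK //= nth_behead mulSn addnC.
Qed.

Lemma recursive1_double : recursive1 double.
Proof.
have := recursive_app2 recursive2_add recursive1_id recursive1_id.
by congr recursive; apply: funext => v; rewrite addnn.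
Qed.

Lemma recursive1_half : recursive1 half.
Proof.
(* The recurrence is [n.+1./2 = n - n./2]. *)
have := recursive_prec (recursive_const 0 0)
  (recursive_app2 recursive2_sub (recursive_proj (ord0 : 'I_2))
     (recursive_proj (inord 1 : 'I_2))).
congr recursive; apply: funext => v; rewrite -/(thead v).
elim: (thead v) => //= n ->.
by rewrite !(tnth_nth 0) !inordK //= uphalf_half -{1}(odd_double_half n) -addnn
  addnA addnK.
Qed.

Lemma recursive1_odd : recursive1 (fun n => odd n).
Proof.
have := recursive_app2 recursive2_sub recursive1_id
  (recursive_app1 recursive1_double recursive1_half).
congr recursive; apply: funext => v.
by rewrite -{1}(odd_double_half (tnth v ord0)) addnK.
Qed.

(** This is one step of [CodeSeq.code]. The head is recovered as the 2-adic valuation and the tail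
    as half of the odd part, rounded down. *)
Definition cons_code x y := 2 ^ x * y.*2.+1.

Lemma recursive2_cons : recursive2 cons_code.
Proof.
have := recursive_app2 (recursive2_iter recursive1_double) recursive2_fst
  (recursive_app1 recursive1_succ (recursive_app1 recursive1_double recursive2_snd)).
congr recursive; apply: funext => v; rewrite /cons_code.
elim: (tnth v ord0) => [|n IH]; first by rewrite mul1n.
by rewrite iterS IH expnS -mulnA mul2n.
Qed.

Definition head_code n := logn 2 n.
Definition tail_code n := (n %/ 2 ^ head_code n)./2.

Lemma iter_half n x : iter n half x = x %/ 2 ^ n.
Proof. by elim: n => [|n IH]; rewrite ?divn1//= IH expnSr divnMA divn2. Qed.

Lemma recursive1_head : recursive1 head_code.
Proof.
(* The valuation is the first [n] for which [iter n half x] is odd. The factor [x] makes the search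
   stop at once for [x = 0], in agreement with [logn 2 0 = 0]. *)
have r1 : recursive2 (fun n x => (1 - odd (iter n half x)) * x).
  apply: (recursive_app2 recursive2_mul); last exact: recursive2_snd.
  apply: (recursive_app2 recursive2_sub); first exact: recursive_const.
  apply: (recursive_app1 recursive1_odd).
  exact: (recursive2_iter recursive1_half).
apply: (recursive_min (F := fun n v => (1 - odd (iter n half (tnth v ord0))) * tnth v ord0)).
- move: r1; congr recursive; apply: funext => v.
  have -> // : tnth [tuple of behead v] ord0 = tnth v (inord 1).
  by rewrite !(tnth_nth 0) nth_behead inordK.
- move=> v; case: (posnP (tnth v ord0)) => [->|x0]; first by rewrite muln0.
  rewrite iter_half /head_code; have [m cm {1}->] := pfactor_coprime (isT : prime 2) x0.
  by rewrite mulnK ?expn_gt0// -coprime2n cm.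
- move=> v z; case: (posnP (tnth v ord0)) => [->|x0]; first by rewrite /head_code logn0.
  rewrite iter_half /head_code => zx; rewrite muln_eq0 negb_or -[_ v _ != 0]lt0n x0 andbT.
  have [m cm ->] := pfactor_coprime (isT : prime 2) x0.
  (* Below the valuation a factor [2] survives the division, so the quotient is even. *)
  rewrite -(subnKC zx) addSnnS expnD mulnCA mulnC mulnK ?expn_gt0//.
  by rewrite expnS oddM oddM andbF.
Qed.

Lemma recursive1_tail : recursive1 tail_code.
Proof.
have := recursive_app1 recursive1_half
  (recursive_app2 (recursive2_iter recursive1_half) recursive1_head recursive1_id).
by congr recursive; apply: funext => v; rewrite iter_half.
Qed.

Lemma cons_codeK x y : head_code (cons_code x y) = x.
Proof.
rewrite /head_code lognM ?expn_gt0// pfactorK// logn_coprime ?addn0//.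
by rewrite coprime2n /= odd_double.
Qed.

Lemma tail_cons_code x y : tail_code (cons_code x y) = y.
Proof.
by rewrite /tail_code cons_codeK /cons_code mulKn ?expn_gt0//= uphalf_double.
Qed.

(** * Computability on encoded types *)

Class encoding (T : Type) := Encoding { enc : T -> nat; enc_inj : injective enc }.

#[export] Instance nat_encoding : encoding nat := Encoding (@inj_id nat).

Lemma tt_enc_inj : injective (fun _ : unit => 0). Proof. by case=> -[]. Qed.
#[export] Instance unit_encoding : encoding unit := Encoding tt_enc_inj.

Lemma bool_enc_inj : injective nat_of_bool. Proof. by case=> -[]. Qed.
#[export] Instance bool_encoding : encoding bool := Encoding bool_enc_inj.

Section Encodings.
Context {A B : Type} {eA : encoding A} {eB : encoding B}.

Lemma pair_enc_inj : injective (fun p : A * B => cons_code (enc p.1) (enc p.2)).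
Proof.
move=> [a b] [a' b'] /= e; congr pair; apply: enc_inj.
  by have := congr1 head_code e; rewrite !cons_codeK.
by have := congr1 tail_code e; rewrite !tail_cons_code.
Qed.

Lemma seq_enc_inj : injective (fun s : seq A => CodeSeq.code (map enc s)).
Proof. exact: inj_comp (can_inj CodeSeq.codeK) (inj_map enc_inj). Qed.

(* The code of [(a, b)] is that of a list with head [a] and tail [b], so the
   heterogeneous lists coded in Defs are nested pairs ending in [tt]. *)
#[export] Instance pair_encoding : encoding (A * B) := Encoding pair_enc_inj.
#[export] Instance seq_encoding : encoding (seq A) := Encoding seq_enc_inj.

Lemma enc_pair (a : A) (b : B) : enc (a, b) = cons_code (enc a) (enc b).
Proof. by []. Qed.

Lemma enc_cons (a : A) (s : seq A) : enc (a :: s) = cons_code (enc a) (enc s).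
Proof. by []. Qed.

(** [CodeSeq.code] is a bijection, so surjectivity passes from entries to lists. An unbounded search
    over all numbers then meets only codes. *)
Lemma enc_seq_surj : (forall n, exists a : A, enc a = n) ->
  forall n, exists s : seq A, enc s = n.
Proof.
move=> /choice[f fE] n; exists (map f (CodeSeq.decode n)).
rewrite -[RHS]CodeSeq.decodeK /=; congr CodeSeq.code.
by rewrite -map_comp map_id_in// => x _; exact: fE.
Qed.

End Encodings.

(* Nothing is required of [r] on numbers that are not codes. *)
Definition computable A B {eA : encoding A} {eB : encoding B} (f : A -> B) :=
  exists r : recfun 1, forall a, recfun_graph r [tuple enc a] (enc (f a)).

Section Computable.
Context {E : Type} {eE : encoding E}.

Lemma computable_id : computable (fun e : E => e).
Proof. by exists (RProj ord0). Qed.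

Lemma computable_comp {A B} {eA : encoding A} {eB : encoding B} (g : A -> B) (f : E -> A) :
  computable g -> computable f -> computable (fun e => g (f e)).
Proof.
move=> [s sg] [r rf]; exists (RComp s (fun _ : 'I_1 => r)) => e /=.
exists [tuple enc (f e)]; last exact: sg.
by move=> i; rewrite [i]ord1 (_ : tnth _ _ = enc (f e)).
Qed.

Lemma computable_const {A} {eA : encoding A} (a : A) : computable (fun _ : E => a).
Proof. by have [r ra] := recursive_const 1 (enc a); exists r. Qed.

Lemma computable1 {A B} {eA : encoding A} {eB : encoding B} (F : nat -> nat)
    (op : A -> B) (f : E -> A) :
  recursive1 F -> (forall a, enc (op a) = F (enc a)) ->
  computable f -> computable (fun e => op (f e)).
Proof.
move=> [r rF] opF; apply: computable_comp; exists r => a.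
by rewrite opF; exact: rF.
Qed.

Lemma computable2 {A B C} {eA : encoding A} {eB : encoding B} {eC : encoding C}
    (F : nat -> nat -> nat) (op : A -> B -> C) (f : E -> A) (g : E -> B) :
  recursive2 F -> (forall a b, enc (op a b) = F (enc a) (enc b)) ->
  computable f -> computable g -> computable (fun e => op (f e) (g e)).
Proof.
move=> [t tF] opF [r rf] [s sg].
exists (RComp t (fun i : 'I_2 => if i == ord0 then r else s)) => e /=.
exists [tuple enc (f e); enc (g e)].
  move=> i; rewrite (tnth_nth 0) -val_eqE.
  by case: i => [[|[|//]] lti] /=.
have e1 : tnth [tuple enc (f e); enc (g e)] (inord 1) = enc (g e).
  by rewrite (tnth_nth 0) inordK.
by rewrite opF -[in F _ _]e1; exact: tF.
Qed.

Lemma computable_pair {A B} {eA : encoding A} {eB : encoding B} (f : E -> A) (g : E -> B) :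
  computable f -> computable g -> computable (fun e => (f e, g e)).
Proof. exact: computable2 recursive2_cons (@enc_pair _ _ _ _). Qed.

Lemma computable_fst {A B} {eA : encoding A} {eB : encoding B} (f : E -> A * B) :
  computable f -> computable (fun e => (f e).1).
Proof. by apply: computable1 recursive1_head _ => p; rewrite /= cons_codeK. Qed.

Lemma computable_snd {A B} {eA : encoding A} {eB : encoding B} (f : E -> A * B) :
  computable f -> computable (fun e => (f e).2).
Proof. by apply: computable1 recursive1_tail _ => p; rewrite /= tail_cons_code. Qed.

Lemma computable_cons {A} {eA : encoding A} (f : E -> A) (g : E -> seq A) :
  computable f -> computable g -> computable (fun e => f e :: g e).
Proof. exact: computable2 recursive2_cons (@enc_cons _ _). Qed.

Lemma computable_behead {A} {eA : encoding A} (f : E -> seq A) :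
  computable f -> computable (fun e => behead (f e)).
Proof.
by apply: computable1 recursive1_tail _ => -[|a s] //; rewrite enc_cons tail_cons_code.
Qed.

Lemma computable_S (f : E -> nat) : computable f -> computable (fun e => (f e).+1).
Proof. exact: computable1 recursive1_succ _. Qed.

Lemma computable_pred (f : E -> nat) : computable f -> computable (fun e => (f e).-1).
Proof. exact: computable1 recursive1_pred _. Qed.

Lemma computable_negb (f : E -> bool) : computable f -> computable (fun e => ~~ f e).
Proof.
apply: (computable1 (F := subn 1)) => [|[]//].
exact: (recursive_app2 recursive2_sub (recursive_const 1 1) recursive1_id).
Qed.

Lemma computable_andb (f g : E -> bool) :
  computable f -> computable g -> computable (fun e => f e && g e).
Proof. by apply: computable2 recursive2_mul _ => -[] []. Qed.

(** Codes are injective, so equality is the vanishing of the sum of the two truncated differences of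
    the codes. *)
Lemma computable_eq (A : eqType) {eA : encoding A} (f g : E -> A) :
  computable f -> computable g -> computable (fun e => f e == g e).
Proof.
apply: (computable2 (F := fun m n => 1 - ((m - n) + (n - m)))) => [|a b].
  apply: (recursive_app2 recursive2_sub (recursive_const _ 1)).
  apply: (recursive_app2 recursive2_add recursive2_sub).
  exact: (recursive_app2 recursive2_sub recursive2_snd recursive2_fst).
rewrite -(inj_eq enc_inj) eqn_leq -!subn_eq0 -addn_eq0.
by case: (_ + _).
Qed.

(** The branch is selected arithmetically, by multiplying the codes of the two values with the test
    and its negation. *)
Lemma computable_if {A} {eA : encoding A} (b : E -> bool) (f g : E -> A) :
  computable b -> computable f -> computable g ->
  computable (fun e => if b e then f e else g e).
Proof.
move=> cb cf cg.
have [r rP] : computable (fun e => b e * enc (f e) + ~~ b e * enc (g e)).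
  apply: (computable2 (op := addn) recursive2_add) => //.
    exact: (computable2 (op := fun (x : bool) (y : nat) => x * y) recursive2_mul).
  apply: (computable2 (op := fun (x : bool) (y : nat) => x * y) recursive2_mul) => //.
  exact: computable_negb.
by exists r => e; have := rP e; rewrite /=; case: (b e); rewrite ?mul1n ?addn0.
Qed.

(** The program for [h] is controlled only on codes, so the recursion is built directly from
    [RPrec]: each intermediate value is the code of some [iter j h (f e)]. *)
Lemma computable_iter_state {A} {eA : encoding A} (h : A -> A) (n : E -> nat) (f : E -> A) :
  computable h -> computable n -> computable f ->
  computable (fun e => iter (n e) h (f e)).
Proof.
move=> [r rh] [s sn] [t tf].
pose I := RPrec (RProj (ord0 : 'I_1)) (RComp r (fun _ : 'I_1 => RProj (inord 1 : 'I_3))).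
exists (RComp I (fun i : 'I_2 => if i == ord0 then s else t)) => e.
exists [tuple n e; enc (f e)].
  move=> i; rewrite (tnth_nth 0) -val_eqE.
  by case: i => [[|[|//]] lti] /=.
exists (fun j => enc (iter j h (f e))); split=> //.
move=> j _; exists [tuple enc (iter j h (f e))]; last exact: rh.
by move=> i; rewrite [i]ord1 /= [RHS](tnth_nth 0) inordK.
Qed.

End Computable.

Section ComputableIter.
Context {E : Type} {eE : encoding E}.

(** The parameter [e] is carried along in the state, which turns the loop body into a single
    function. *)
Lemma computable_iter {A} {eA : encoding A} (h : E -> A -> A) (n : E -> nat) (f : E -> A) :
  computable (fun p : E * A => h p.1 p.2) -> computable n -> computable f ->
  computable (fun e => iter (n e) (h e) (f e)).
Proof.
move=> ch cn cf.
have -> : (fun e => iter (n e) (h e) (f e)) =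
    fun e => (iter (n e) (fun p : E * A => (p.1, h p.1 p.2)) (e, f e)).2.
  apply: funext => e; suff -> : iter (n e) (fun p : E * A => (p.1, h p.1 p.2)) (e, f e)
    = (e, iter (n e) (h e) (f e)) by [].
  by elim: (n e) => //= k ->.
apply/computable_snd/computable_iter_state => //.
  exact/computable_pair/ch/computable_fst/computable_id.
exact/computable_pair/cf/computable_id.
Qed.

Lemma computable_head {A : eqType} {eA : encoding A} (a0 : A) (f : E -> seq A) :
  computable f -> computable (fun e => head a0 (f e)).
Proof.
(* The empty list is tested apart: its code [0] has [head_code] equal to [0], which need not be the
   code of [a0]. *)
move=> cf; have [r rP] : computable (fun e => if f e == [::] then enc a0 else head_code (enc (f e))).
  apply: computable_if; first exact/computable_eq/computable_const.
    exact: computable_const.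
  exact: (computable1 (op := fun s : seq A => head_code (enc s)) recursive1_head).
exists r => e; have := rP e; case: (f e) => //= a s.
by rewrite -/(cons_code _ _) cons_codeK.
Qed.

End ComputableIter.

Section ComputableFold.
Context {E : Type} {eE : encoding E}.

(* The loop runs [enc s >= size s] times and idles once the list is exhausted. *)
Lemma computable_foldl {A : eqType} {B} {eA : encoding A} {eB : encoding B} (a0 : A)
    (h : E -> B -> A -> B) (b : E -> B) (s : E -> seq A) :
  computable (fun p : E * (B * A) => h p.1 p.2.1 p.2.2) ->
  computable b -> computable s ->
  computable (fun e => foldl (h e) (b e) (s e)).
Proof.
move=> ch cb cs.
pose st e (p : B * seq A) :=
  if p.2 == [::] then p else (h e p.1 (head a0 p.2), behead p.2).
have -> : (fun e => foldl (h e) (b e) (s e)) =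
    fun e => (iter (enc (s e)) (st e) (b e, s e)).1.
  apply: funext => e.
  have : size (s e) <= enc (s e).
    (* Adding an entry to a list with code [y] gives a code of at least [y.*2.+1]. *)
    elim: (s e) => //= a r IH; rewrite (leq_trans _ (leq_pmull _ _)) ?expn_gt0//.
    by rewrite ltnS -addnn (leq_trans IH)// leq_addr.
  move: (enc (s e)) => n; elim: n (b e) (s e) => [|n IH] c [|a r] //= lt_r.
    by rewrite -iterS iterSr /st eqxx -IH.
  by rewrite -iterS iterSr -IH.
apply/computable_fst/computable_iter; last exact: computable_pair.
  have cp : computable (fun p : E * (B * seq A) => p.2) by exact/computable_snd/computable_id.
  apply: computable_if => //.
    by apply: computable_eq; [exact/computable_snd|exact: computable_const].
  apply: computable_pair; last exact/computable_behead/computable_snd.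
  apply: (computable_comp ch (f := fun p : E * (B * seq A) => (p.1, (p.2.1, head a0 p.2.2)))).
  apply: computable_pair; first exact/computable_fst/computable_id.
  apply: computable_pair; first exact/computable_fst.
  exact/computable_head/computable_snd.
(* The program computing the list [s e] also computes the number [enc (s e)], since numbers encode
   themselves. *)
by case: cs => r rP; exists r.
Qed.

End ComputableFold.

Section ComputableSeq.
Context {E : Type} {eE : encoding E}.

Lemma computable_all {A : eqType} {eA : encoding A} (a0 : A) (P : E -> A -> bool) (s : E -> seq A) :
  computable (fun p : E * A => P p.1 p.2) -> computable s ->
  computable (fun e => all (P e) (s e)).
Proof.
move=> cP cs.
have -> : (fun e => all (P e) (s e)) =
    fun e => foldl (fun b a => b && P e a) true (s e).
  apply: funext => e; rewrite -[LHS]andTb.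
  by elim: (s e) true => [|a r IH] b /=; rewrite ?andbT// andbA IH.
apply: (computable_foldl a0 (h := fun e b a => b && P e a)) => //; last exact: computable_const.
have cp : computable (fun p : E * (bool * A) => p.2) by exact/computable_snd/computable_id.
apply: computable_andb; first exact: computable_fst.
apply: (computable_comp cP (f := fun p : E * (bool * A) => (p.1, p.2.2))).
by apply: computable_pair; [exact/computable_fst/computable_id|exact: computable_snd].
Qed.

End ComputableSeq.

Section ComputableMem.
Context {E : Type} {eE : encoding E}.

Lemma computable_mem {A : eqType} {eA : encoding A} (a0 : A) (a : E -> A) (s : E -> seq A) :
  computable a -> computable s -> computable (fun e => a e \in s e).
Proof.
move=> ca cs; have -> : (fun e => a e \in s e) = fun e => ~~ all (fun x => x != a e) (s e).
  by apply: funext => e; rewrite -has_pred1 (eq_all (a2 := predC (pred1 (a e))))// all_predC negbK.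
apply/computable_negb/(computable_all a0 (P := fun e x => x != a e)) => //.
apply/computable_negb/computable_eq; first exact/computable_snd/computable_id.
exact/(computable_comp ca)/computable_fst/computable_id.
Qed.

Lemma computable_nth {A : eqType} {eA : encoding A} (a0 : A) (s : E -> seq A) (n : E -> nat) :
  computable s -> computable n -> computable (fun e => nth a0 (s e) (n e)).
Proof.
move=> cs cn; have -> : (fun e => nth a0 (s e) (n e)) = fun e => head a0 (iter (n e) behead (s e)).
  apply: funext => e; elim: (n e) (s e) => [|k IH] [|x r] //; rewrite iterSr -IH //=.
  by rewrite nth_nil.
apply/computable_head/computable_iter => //.
exact/computable_behead/computable_snd/computable_id.
Qed.

Lemma computable_rev {A : eqType} {eA : encoding A} (a0 : A) (s : E -> seq A) :
  computable s -> computable (fun e => rev (s e)).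
Proof.
move=> cs; have -> : (fun e => rev (s e)) = fun e => foldl (fun r a => a :: r) [::] (s e).
  by apply: funext => e; rewrite /rev; elim: (s e) [::] => //= a r IH t; rewrite IH.
apply: (computable_foldl a0 (h := fun _ r a => a :: r)) => //; last exact: computable_const.
have cp : computable (fun p : E * (seq A * A) => p.2) by exact/computable_snd/computable_id.
by apply: computable_cons; [exact: computable_snd|exact: computable_fst].
Qed.

End ComputableMem.

Lemma computable_rcons {E} {eE : encoding E} {A : eqType} {eA : encoding A} (a0 : A)
    (s : E -> seq A) (a : E -> A) :
  computable s -> computable a -> computable (fun e => rcons (s e) (a e)).
Proof.
move=> cs ca.
have -> : (fun e => rcons (s e) (a e)) = fun e => rev (a e :: rev (s e)).
  by apply: funext => e; rewrite rev_cons revK.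
exact/(computable_rev a0)/computable_cons/(computable_rev a0).
Qed.

(** * Sections of bounded automorphisms along a ray *)

Section BoundedAutomorphisms.
Variable d : nat.
Implicit Types (a b s : taut d) (u v : seq 'I_d) (eta : ray d).

Lemma section_cat a u v : section a (u ++ v) = section (section a u) v.
Proof.
apply/esym/section_unique => t; rewrite -catA sectionE [section a u _]sectionE.
by rewrite catA -sectionE.
Qed.

Lemma section_nil a : section a [::] = a.
Proof. by apply/esym/section_unique => u; rewrite taut_root. Qed.

Lemma section_one v : section (1%g : taut d) v = 1%g.
Proof. exact/esym/section_unique. Qed.

Lemma section_mul a b v : section (a * b)%g v = (section a v * section b (a v))%g.
Proof.
apply/esym/section_unique => u.
by change (b (a (v ++ u)) = b (a v) ++ section b (a v) (section a v u));
   rewrite [a (v ++ u)]sectionE sectionE.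
Qed.

Lemma bounded_automaton_one : bounded_automaton_aut (1%g : taut d).
Proof.
split=> [|].
  apply: (sub_finite_set _ (finite_set1 (1%g : taut d))) => _ [v _ <-].
  exact: section_one.
exists 1 => k _; rewrite ltnS leqn0 cards_eq0; apply/eqP/setP => v.
by rewrite !inE section_one eqxx.
Qed.

(** A section of the product at [v] is nontrivial only if that of [a] at [v] or that of [b] at [a v]
    is. As [a] permutes each level, the two bounds add up. *)
Lemma bounded_automaton_mul a b : bounded_automaton_aut a ->
  bounded_automaton_aut b -> bounded_automaton_aut (a * b)%g.
Proof.
move=> [fa [M Ma]] [fb [N Nb]]; split.
  apply: (sub_finite_set _ (finite_image2 (@taut_mul d) fa fb)) => _ [v _ <-].
  by exists (section a v); [exists v|exists (section b (a v)); [exists (a v)|rewrite section_mul]].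
exists (M + N) => k k0.
have sz (v : k.-tuple 'I_d) : size (a v) == k by rewrite size_taut size_tuple.
pose f (v : k.-tuple _) := Tuple (sz v).
have f_inj : injective f.
  move=> v w /(congr1 val)/= /(can_inj (@taut_funK _ a)); exact: val_inj.
set Sa := [set v : k.-tuple 'I_d | section a v != 1%g]%SET.
set Sb := [set v : k.-tuple 'I_d | section b v != 1%g]%SET.
have sub : [set v : k.-tuple 'I_d | section (a * b)%g v != 1%g]%SET \subset
    (Sa :|: f @^-1: Sb)%SET.
  apply/fintype.subsetP => v; rewrite !inE section_mul; apply: contraNT.
  by rewrite negb_or !negbK => /andP[/eqP-> /eqP->]; rewrite mulg1.
rewrite (leq_ltn_trans (subset_leq_card sub))//.
rewrite (leq_ltn_trans (leq_card_setU _ _))// card_preimset//.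
by rewrite -addSn leq_add ?Ma// ltnW ?Nb.
Qed.

Lemma bounded_automaton_prod (gs : seq (taut d)) :
  (forall a, a \in gs -> bounded_automaton_aut a) ->
  bounded_automaton_aut (\big[*%g/1%g]_(a <- gs) a)%g.
Proof.
move=> bgs; rewrite big_seq; apply: big_ind => //.
  exact: bounded_automaton_one.
exact: bounded_automaton_mul.
Qed.

(* Otherwise the words in [u ++ v] and [v ++ u] lead from [v0] to exponentially
   many vertices of the same level, all with section [s]. *)
Lemma loops_commute a v0 s u v :
  bounded_automaton_aut a -> section a v0 = s -> s != 1%g ->
  section s u = s -> section s v = s -> u ++ v = v ++ u.
Proof.
move=> [_ [N bN]] sv0 s1 su sv; apply/eqP; apply: contraT => uv.
(* The two blocks are distinct and of equal length, so a concatenation of blocks determines the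
   sequence of choices, and its length depends only on their number. *)
pose w (b : bool) := if b then u ++ v else v ++ u.
have sw (c : bool) : size (w c) = size u + size v by case: c; rewrite size_cat // addnC.
have w_inj : injective w by case=> -[]//= e; move: uv; rewrite e eqxx.
pose W (bs : seq bool) := flatten (map w bs).
have sW bs : size (W bs) = size bs * (size u + size v).
  by elim: bs => //= b bs IH; rewrite /W/= size_cat -/(W bs) IH sw mulSn.
have WE bs : section s (W bs) = s.
  elim: bs => [|b bs IH]; first exact: section_nil.
  rewrite /W/= section_cat.
  by have -> : section s (w b) = s by case: b; rewrite section_cat ?su ?sv ?su.
have uv0 : 0 < size u + size v.
  by move: uv; rewrite lt0n; apply: contra => /eqP; case: u v {su sv w sw w_inj W sW WE} => [|? ?] [|? ?].
have N0 : 0 < N by exact: leq_ltn_trans (leq0n _) (bN 1 isT).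
pose k := size v0 + N * (size u + size v).
have sz (bs : N.-tuple bool) : size (v0 ++ W bs) == k.
  by rewrite size_cat sW size_tuple.
pose f bs : k.-tuple 'I_d := Tuple (sz bs).
have W_inj (bs cs : seq bool) : size bs = size cs -> W bs = W cs -> bs = cs.
  elim: bs cs => [|b bs IH] [|c cs] //= [e]; rewrite /W /= => /eqP.
  by rewrite eqseq_cat ?sw// => /andP[/eqP/w_inj-> /eqP/IH->].
have f_inj : injective f.
  move=> bs cs /(congr1 val)/= /eqP; rewrite eqseq_cat// eqxx => /eqP We.
  by apply/val_inj/W_inj; rewrite ?size_tuple.
(* The bound [N] is available on positive levels only. *)
have k0 : 0 < k by rewrite addn_gt0 muln_gt0 N0 uv0 orbT.
have := bN k k0; rewrite ltnNge => /negP[].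
(* The [2 ^ N] sequences of choices exceed the bound [N]. *)
rewrite (leq_trans (ltnW (ltn_expl N (ltnSn 1))))//.
rewrite -[leqLHS](_ : #|f @: [set: N.-tuple bool]| = _); last first.
  by rewrite card_imset// cardsT card_tuple card_bool.
apply/subset_leq_card/fintype.subsetP => _ /imsetP[bs _ ->].
by rewrite inE /= section_cat sv0 WE.
Qed.

(** Otherwise each of the finitely many sections stops occurring from some level on, and beyond the
    largest of these levels no section would be left. *)
Lemma recurrent_section a eta : automaton_aut a ->
  exists s, forall n, exists2 m, n <= m & section a (mkseq eta m) = s.
Proof.
move=> /finite_seqP[l lE]; apply: contrapT => /forallNP no.
have: exists n, forall m, n <= m -> section a (mkseq eta m) \notin l.
  elim: l {lE} => [|s l [n nl]]; first by exists 0.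
  have /existsNP[p np] := no s; exists (maxn n p) => m.
  rewrite geq_max inE negb_or => /andP[nm pm]; rewrite nl// andbT.
  by apply/eqP => e; apply: np; exists m.
case=> n /(_ n (leqnn n))/negP; apply.
have : range (section a) (section a (mkseq eta n)) by exists (mkseq eta n).
by rewrite lE.
Qed.

Lemma mkseq_add (T : Type) (f : nat -> T) m n :
  mkseq f (m + n) = mkseq f m ++ mkseq (fun i => f (m + i)) n.
Proof.
rewrite /mkseq iotaD map_cat add0n; congr cat.
by rewrite -[in LHS](addn0 m) iotaDl -map_comp.
Qed.

Lemma eventually_periodic_shift eta p q : 0 < q ->
  (forall i, eta (p + (q + i)) = eta (p + i)) -> eventually_periodic eta.
Proof.
move=> q0 per; exists (mkseq eta p), (mkseq (fun i => eta (p + i)) q).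
rewrite -size_eq0 !size_mkseq -lt0n; split=> // n.
case: ltnP => [np|/subnKC <-]; first by rewrite nth_mkseq.
rewrite addKn nth_mkseq ?ltn_mod// {1}(divn_eq (n - p) q).
by elim: (_ %/ q) => [//|k IH]; rewrite mulSn -addnA per.
Qed.

(** One fixed return loop at a recurrent section commutes with arbitrarily long return loops, which
    makes its length a period of the ray. *)
Lemma nontrivial_sections_periodic a eta : bounded_automaton_aut a ->
  (forall n, section a (mkseq eta n) != 1%g) -> eventually_periodic eta.
Proof.
move=> ba nt; have [s rec] := recurrent_section eta ba.1.
have [p _ ps] := rec 0; have s1 : s != 1%g by rewrite -ps nt.
pose L n := mkseq (fun i => eta (p + i)) n.
have loop n : section a (mkseq eta (p + n)) = s -> section s (L n) = s.
  by rewrite mkseq_add section_cat ps.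
(* Asking for a return from level [p.+1] on makes the loop length [q] positive. *)
have [m pm ms] := rec p.+1.
have pK := subnKC (ltnW pm); pose q := m - p.
apply: (@eventually_periodic_shift _ p q); first by rewrite subn_gt0.
(* The second loop is chosen long enough to contain the letter at offset [q + i]. *)
move=> i; have [n ni ns] := rec (p + (q + i).+1).
have nK := subnKC (leq_trans (leq_addr _ _) ni).
have qin : q + i < n - p by rewrite ltn_subRL -addnS.
have comm : L q ++ L (n - p) = L (n - p) ++ L q.
  by apply: (loops_commute ba ps s1); apply: loop; rewrite ?pK ?nK.
(* At position [q + i], one product shows [eta (p + i)] and the other [eta (p + (q + i))]. *)
move/(congr1 (fun t => nth (eta 0) t (q + i))): comm.
rewrite !nth_cat !size_mkseq qin ltnNge leq_addr /= addKn !nth_mkseq//.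
exact: leq_ltn_trans (leq_addl _ _) qin.
Qed.

(** [ray_act] reads only the last letter of the image of a prefix; the earlier letters form the
    image of the preceding prefix, so induction on the length applies. *)
Lemma ray_act_fix eta a :
  ray_act eta a = eta <-> forall n, a (mkseq eta n) = mkseq eta n.
Proof.
split=> [fix_eta n|fix_eta]; last first.
  by apply: funext => n; rewrite /ray_act fix_eta nth_mkseq.
elim: n => [|n IH]; first by rewrite taut_root.
have := congr1 (fun f : ray d => f n) fix_eta; rewrite /ray_act.
rewrite mkseqS.
have [c ->] := taut_rcons a (mkseq eta n) (eta n).
by rewrite IH nth_rcons size_mkseq ltnn eqxx => ->.
Qed.

End BoundedAutomorphisms.

(** * Search for a certificate *)

Section Search.
Context {I Y : Type} {eI : encoding I} {eY : encoding Y}.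

(** The search runs through the codes of all [y]. The program for [P] is controlled only on codes,
    so [surj] is what makes every test below the least witness halt. *)
Lemma computable_search (P Q : I * Y -> bool) :
  (forall n, exists y : Y, enc y = n) -> computable P -> computable Q ->
  exists D : recfun 1, forall i, (exists y, P (i, y)) ->
    exists y, P (i, y) /\ recfun_graph D [tuple enc i] (Q (i, y)).
Proof.
(* [RMin] looks for the value [0], hence the negation of [P]. *)
move=> surj /computable_negb[p pP] [q qP]; have [c cP] := recursive2_cons.
have cE a b : recfun_graph c [tuple a; b] (cons_code a b).
  have := cP [tuple a; b].
  by have -> : tnth [tuple a; b] (inord 1) = b by rewrite (tnth_nth 0) inordK.
pose pair_of k (f g : recfun k) := RComp c (fun i : 'I_2 => if i == ord0 then f else g).
have pairE k (f g : recfun k) v a b : recfun_graph f v a -> recfun_graph g v b ->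
    recfun_graph (pair_of k f g) v (cons_code a b).
  move=> fa gb; exists [tuple a; b]; last exact: cE.
  by move=> i; rewrite (tnth_nth 0) -val_eqE; case: i => [[|[|//]] lti].
pose test := RComp p (fun _ : 'I_1 => pair_of _ (RProj (inord 1 : 'I_2)) (RProj ord0)).
have testE i y : recfun_graph test [tuple enc y; enc i] (~~ P (i, y)).
  exists [tuple enc (i, y)]; last exact: pP.
  move=> j; rewrite [j]ord1; apply: pairE => //=.
  by rewrite (tnth_nth 0) inordK.
exists (RComp q (fun _ : 'I_1 => pair_of _ (RProj ord0) (RMin test))) => i [y Py].
have ex_n : exists n, `[< exists2 z, enc z = n & P (i, z) >].
  by exists (enc y); apply/asboolP; exists y.
case: (ex_minnP ex_n) => _ /asboolP[z <- Pz] min_z; exists z; split=> //.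
exists [tuple enc (i, z)]; last exact: qP.
move=> j; rewrite [j]ord1; apply: pairE => //=; split=> [|n lt_n].
  have := testE i z; rewrite Pz; congr recfun_graph; exact: val_inj.
have [x xn] := surj n; exists 0; have := testE i x; rewrite xn.
have -> : P (i, x) = false.
  apply/negP => Px; have := min_z n; rewrite leqNgt lt_n => /(_ _)/negP[] //.
  by apply/asboolP; exists x.
by congr recfun_graph; exact: val_inj.
Qed.

End Search.

(** * Numerical programs for the machine, the automata and the certificates *)

Definition table := seq (seq (seq nat)).

(** A configuration lists the state, the left tape, the right tape and the output. An action lists
    the new state, the written symbol, the move and the output, where [0] writes nothing and [c.+1]
    writes [c]; the empty action halts. *)
Definition ntm_step (T : table) (c : nat * (seq nat * (seq nat * seq nat))) :=
  let act := nth [::] (nth [::] T c.1) (head 0 c.2.2.1) in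
  if act == [::] then c else
  (nth 0 act 0,
   (if nth 0 act 2 == 0 then behead c.2.1 else
    if nth 0 act 2 == 1 then c.2.1 else nth 0 act 1 :: c.2.1,
   (if nth 0 act 2 == 0 then head 0 c.2.1 :: nth 0 act 1 :: behead c.2.2.1 else
    if nth 0 act 2 == 1 then nth 0 act 1 :: behead c.2.2.1 else behead c.2.2.1,
    if nth 0 act 3 == 0 then c.2.2.2 else rcons c.2.2.2 (nth 0 act 3).-1))).

Definition ntm_out (T : table) t :=
  (iter t (ntm_step T) (0, ([::], ([::], [::])))).2.2.2.

Definition nautomaton := (nat * (table * unit))%type.

(** The list [p] is [[:: i; q]], for state [q] of the automaton number [i]; the result consists of
    the output letter and the next state. *)
Definition ntrans (As : seq nautomaton) (p : seq nat) c :=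
  nth [::] (nth [::] (nth (0, ([::], tt)) As (nth 0 p 0)).2.1 (nth 0 p 1)) c.

(** The letter passes through the states of [qs] from left to right, each output being the next
    input; the new states are collected on the way. *)
Definition nstep (As : seq nautomaton) (c : nat) (qs : seq (seq nat)) :=
  foldl (fun b p => (nth 0 (ntrans As p b.1) 0,
      rcons b.2 [:: nth 0 p 0; nth 0 (ntrans As p b.1) 1])) (c, [::]) qs.

(** The Boolean records whether all letters read so far were fixed; the other component is the
    current state vector. *)
Definition nrun (As : seq nautomaton) (qs : seq (seq nat)) (o : seq nat) :=
  foldl (fun b c => (b.1 && ((nstep As c b.2).1 == c), (nstep As c b.2).2))
    (true, qs) o.

Definition ninit (As : seq nautomaton) (w : seq nat) : seq (seq nat) :=
  foldl (fun s i => rcons s [:: i; (nth (0, ([::], tt)) As i).1]) [::] w.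

Definition letters d : seq nat :=
  (iter d (fun p => (p.1.+1, p.1 :: p.2)) (0, [::])).2.

Definition nclosed d (As : seq nautomaton) (L : seq (seq (seq nat))) :=
  all (fun qs => all (fun c =>
    ((nstep As c qs).1 == c) && ((nstep As c qs).2 \in L)) (letters d)) L.

Definition ninstance := (nat * (seq nautomaton * (seq nat * (table * unit))))%type.
Definition ncertificate := seq (seq (seq (seq nat))).

(* A certificate [y] is read as the candidate closed set [head [::] y] of state
   vectors and the number [size (behead y)] of steps of the Turing machine.
   Every number codes one, so the search ranges over all of [nat]. *)
Definition cert_run (p : ninstance * ncertificate) :=
  nrun p.1.2.1 (ninit p.1.2.1 p.1.2.2.1) (ntm_out p.1.2.2.2.1 (size (behead p.2))).

Definition moves p := ~~ (cert_run p).1.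
Definition fixes (p : ninstance * ncertificate) :=
  [&& (cert_run p).1, (cert_run p).2 \in head [::] p.2 &
      nclosed p.1.1 p.1.2.1 (head [::] p.2)].

(** * Computability of the programs *)

Section ProgramsComputable.

Ltac comp_step :=
  match goal with
  | H : computable ?f |- computable ?f => exact: H
  | |- computable (fun p => p) => exact: computable_id
  | |- computable (fun _ => ?c) => exact: computable_const
  | |- computable fst => exact: (computable_fst computable_id)
  | |- computable snd => exact: (computable_snd computable_id)
  | |- computable (fun p => fst _) => apply: computable_fst
  | |- computable (fun p => snd _) => apply: computable_snd
  | |- computable (fun p => nth _ _ _) => apply: computable_nth
  | |- computable (fun p => head _ _) => apply: computable_head
  | |- computable (fun p => behead _) => apply: computable_behead
  | |- computable (fun p => S _) => apply: computable_S
  | |- computable (fun p => predn _) => apply: computable_pred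
  | |- computable (fun p => if _ then _ else _) => apply: computable_if
  | |- computable (fun p => eq_op _ _) => apply: computable_eq
  | |- computable (fun p => andb _ _) => apply: computable_andb
  | |- computable (fun p => negb _) => apply: computable_negb
  | |- computable (fun p => rcons _ _) =>
      first [apply: (computable_rcons 0) | apply: (computable_rcons [::])]
  | |- computable (fun p => cons _ _) => apply: computable_cons
  | |- computable (fun p => pair _ _) => apply: computable_pair
  | H : computable ?f |- computable (fun p => ?f (@?g p)) =>
      apply: (computable_comp H (f := g))
  end.

Ltac comp_simple := repeat comp_step.

Section Steps.
Context {E : Type} {eE : encoding E}.

Lemma computable_tm_step (T : E -> table) c :
  computable T -> computable c -> computable (fun e => ntm_step (T e) (c e)).
Proof. by move=> cT cc; rewrite /ntm_step; comp_simple. Qed.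

Lemma computable_trans (As : E -> seq nautomaton) p c :
  computable As -> computable p -> computable c ->
  computable (fun e => ntrans (As e) (p e) (c e)).
Proof. by move=> cA cp cc; rewrite /ntrans; comp_simple. Qed.

Lemma computable_letters (d : E -> nat) : computable d -> computable (fun e => letters (d e)).
Proof.
move=> cd; apply/computable_snd/(computable_iter (h := fun _ p => (p.1.+1, p.1 :: p.2)));
  comp_simple.
Qed.

Lemma computable_init As w :
  computable As -> computable w -> computable (fun e : E => ninit (As e) (w e)).
Proof.
move=> cA cw; apply: (computable_foldl 0
  (h := fun e s i => rcons s [:: i; (nth (0, ([::], tt)) (As e) i).1])); comp_simple.
Qed.

End Steps.

Lemma computable_tm_out {E} {eE : encoding E} (T : E -> table) t :
  computable T -> computable t -> computable (fun e => ntm_out (T e) (t e)).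
Proof.
move=> cT ct; do 3!apply: computable_snd.
apply: (computable_iter (h := fun e => ntm_step (T e))); comp_simple.
by apply: (computable_tm_step (T := fun p => T p.1) (c := fun p => p.2)); comp_simple.
Qed.

Lemma computable_step {E} {eE : encoding E} As c qs :
  computable As -> computable c -> computable qs ->
  computable (fun e : E => nstep (As e) (c e) (qs e)).
Proof.
move=> cA cc cq; apply: (computable_foldl [::]
  (h := fun e b p => (nth 0 (ntrans (As e) p b.1) 0,
      rcons b.2 [:: nth 0 p 0; nth 0 (ntrans (As e) p b.1) 1]))); comp_simple;
  apply: (computable_trans (As := fun p => As p.1) (p := fun p => p.2.2)
            (c := fun p => p.2.1.1)); comp_simple.
Qed.

Lemma computable_run {E} {eE : encoding E} As qs o :
  computable As -> computable qs -> computable o ->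
  computable (fun e : E => nrun (As e) (qs e) (o e)).
Proof.
move=> cA cq co; apply: (computable_foldl 0 (h := fun e b c =>
  (b.1 && ((nstep (As e) c b.2).1 == c), (nstep (As e) c b.2).2))); comp_simple;
  apply: (computable_step (As := fun p => As p.1) (c := fun p => p.2.2)
            (qs := fun p => p.2.1.2)); comp_simple.
Qed.

Lemma computable_closed {E} {eE : encoding E} d As L :
  computable d -> computable As -> computable L ->
  computable (fun e : E => nclosed (d e) (As e) (L e)).
Proof.
move=> cd cA cL; pose P e qs c :=
  ((nstep (As e) c qs).1 == c) && ((nstep (As e) c qs).2 \in L e).
apply: (computable_all [::] (P := fun e qs => all (P e qs) (letters (d e)))); comp_simple.
apply: (computable_all 0 (P := fun e c => P e.1 e.2 c)); last first.
  by apply: (computable_letters (d := fun p => d p.1)); comp_simple.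
have cs : computable (fun p : E * seq (seq nat) * nat => nstep (As p.1.1) p.2 p.1.2).
  by apply: (computable_step (As := fun p => As p.1.1) (c := fun p => p.2)
    (qs := fun p => p.1.2)); comp_simple.
rewrite /P; comp_simple.
apply: (computable_mem [::] (a := fun p => (nstep (As p.1.1) p.2 p.1.2).2)
  (s := fun p => L p.1.1)); comp_simple.
Qed.

Lemma computable_size {E} {eE : encoding E} {A : eqType} {eA : encoding A} (a0 : A) s :
  computable s -> computable (fun e : E => size (s e : seq A)).
Proof.
move=> cs; have -> : (fun e => size (s e)) = fun e => foldl (fun n _ => n.+1) 0 (s e).
  by apply: funext => e; rewrite -[LHS]add0n; elim: (s e) 0 => [|a r IH] n /=;
    rewrite ?addn0// -IH addSnnS.
apply: (computable_foldl a0 (h := fun _ n _ => n.+1)); comp_simple.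
Qed.

Lemma computable_cert_run : computable cert_run.
Proof.
have cA : computable (fun p : ninstance * ncertificate => p.1.2.1) by comp_simple.
apply: (computable_run (qs := fun p => ninit p.1.2.1 p.1.2.2.1)
  (o := fun p => ntm_out p.1.2.2.2.1 (size (behead p.2)))) => //.
  by apply: (computable_init (w := fun p => p.1.2.2.1)); comp_simple.
apply: (computable_tm_out (T := fun p => p.1.2.2.2.1) (t := fun p => size (behead p.2))).
  by comp_simple.
by apply: (computable_size [::] (s := fun p => behead p.2)); comp_simple.
Qed.

Lemma computable_moves : computable moves.
Proof. exact/computable_negb/computable_fst/computable_cert_run. Qed.

Lemma computable_fixes : computable fixes.
Proof.
have cL : computable (fun p : ninstance * ncertificate => head [::] p.2) by comp_simple.
apply: computable_andb; first exact/computable_fst/computable_cert_run.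
apply: computable_andb.
  apply: (computable_mem [::] (a := fun p => (cert_run p).2)) => //.
  exact/computable_snd/computable_cert_run.
by apply: (computable_closed (d := fun p => p.1.1) (As := fun p => p.1.2.1)); comp_simple.
Qed.

End ProgramsComputable.

(** * Correctness of the programs *)

(** [codom] lists values in the order of the ordinals, so lookups in numerical tables agree with the
    finite functions they come from. *)
Lemma nth_map_codom n (U V : Type) (h : U -> V) (v0 : V) (f : 'I_n -> U) (i : 'I_n) :
  nth v0 (map h (codom f)) i = h (f i).
Proof.
have lti : i < size (codom f) by rewrite size_codom card_ord.
rewrite (nth_map (f i))// codomE (nth_map i) -?enumT ?size_enum_ord//.
by rewrite nth_ord_enum.
Qed.

Lemma mem_letters d c : (c \in letters d) = (c < d).
Proof.
rewrite /letters; set F := (F in iter _ F).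
have [] : (iter d F (0, [::])).1 = d /\ ((c \in (iter d F (0, [::])).2) = (c < d)).
  elim: d => [|d [e IH]]; first by split. rewrite /= e; split=> //.
  by rewrite inE IH [in RHS]ltnS [in RHS]leq_eqVlt.
by [].
Qed.

(** * Simulation of the Turing machine *)

Section TuringMachine.
Variables (d : nat) (T : tm d).

Definition num_action n k (x : option ('I_n * 'I_k * move * option 'I_d)) : seq nat :=
  if x is Some (q, s, m, o) then
    [:: nat_of_ord q; nat_of_ord s; code_move m; if o is Some c then (nat_of_ord c).+1 else 0]
  else [::].

Definition num_tm : table :=
  map (fun row : {ffun _ -> _} => map (@num_action _ _) (codom row)) (codom (tm_delta T)).

Lemma enc_nat_seq (s : seq nat) : enc s = CodeSeq.code s.
Proof. by rewrite /= map_id. Qed.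

Lemma enc_num_tm : enc num_tm = code_tm T.
Proof.
rewrite /code_tm /code_list /= /num_tm -map_comp; congr CodeSeq.code.
apply: eq_map => row /=; rewrite -map_comp; congr CodeSeq.code.
by apply: eq_map => -[[[[q s] m] o]|] //=.
Qed.

Definition num_config (c : config T) : nat * (seq nat * (seq nat * seq nat)) :=
  (nat_of_ord (cfg_state c), (map val (cfg_left c), (map val (cfg_right c), map val (cfg_out c)))).

Lemma ntm_stepE c : ntm_step num_tm (num_config c) = num_config (tm_step c).
Proof.
case: c => q l r o; rewrite /ntm_step /tm_step /num_config /=.
have -> : head 0 (map val r) = head ord0 r by case: r.
rewrite /num_tm nth_map_codom nth_map_codom.
case: (tm_delta T q (head ord0 r)) => [[[[q' s] m] x]|] //=.
by case: m x => -[c|] /=; rewrite ?map_rcons ?behead_map//; case: l.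
Qed.

Lemma ntm_outE t : ntm_out num_tm t = map val (cfg_out (iter t (@tm_step d T) (tm_init T))).
Proof.
rewrite /ntm_out.
have -> : iter t (ntm_step num_tm) (0, ([::], ([::], [::]))) =
    num_config (iter t (@tm_step d T) (tm_init T)) by elim: t => //= t ->; rewrite ntm_stepE.
by [].
Qed.

Lemma prefix_tm_step c : prefix (cfg_out c) (cfg_out (@tm_step d T c)).
Proof.
case: c => q l r o /=; case: (tm_delta T q (head ord0 r)) => [[[[q' s] m] x]|] /=.
  by case: m x => -[y|]; rewrite ?prefix_refl// prefix_rcons.
exact: prefix_refl.
Qed.

Lemma tm_outputs_mkseq eta t : tm_outputs T eta ->
  let o := cfg_out (iter t (@tm_step d T) (tm_init T)) in o = mkseq eta (size o).
Proof.
set out := fun t => cfg_out (iter t (@tm_step d T) (tm_init T)).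
have out_le t1 t2 : t1 <= t2 -> prefix (out t1) (out t2).
  move=> /subnKC <-; elim: (t2 - t1) => [|n IH]; first by rewrite addn0 prefix_refl.
  by rewrite addnS (prefix_trans IH)//; exact: prefix_tm_step.
(* Asking for one letter more than [out t] has forces [t <= t'], since outputs only grow. *)
move=> /(_ (size (out t)).+1)[t' pre] /=; rewrite -/(out t).
have le_t : t <= t'.
  rewrite leqNgt; apply/negP => /ltnW/out_le/(prefix_trans pre)/size_prefix.
  by rewrite size_mkseq ltnn.
have /prefixP[r oE] := out_le _ _ le_t; move: pre; rewrite -/(out t') oE => /prefixP[r'].
move/(congr1 (take (size (out t)))); rewrite take_size_cat// => ->.
rewrite takel_cat ?size_mkseq// mkseqS -cats1 takel_cat ?size_mkseq//.
by rewrite take_oversize ?size_mkseq.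
Qed.

Lemma tm_outputs_size eta n : tm_outputs T eta ->
  exists t, n <= size (cfg_out (iter t (@tm_step d T) (tm_init T))).
Proof.
by move=> /(_ n)[t /size_prefix]; rewrite size_mkseq => ?; exists t.
Qed.

End TuringMachine.

(** * The product automaton of a word *)

Section ProductAutomaton.
Variables (d m : nat) (A : m.-tuple (automaton d)).

Definition num_automaton (B : automaton d) : nautomaton :=
  (nat_of_ord (aut_init B),
   (map (fun row : {ffun 'I_d -> 'I_d * 'I_(aut_size B)} =>
      map (fun p : 'I_d * 'I_(aut_size B) => [:: nat_of_ord p.1; nat_of_ord p.2]) (codom row))
      (codom (aut_delta B)), tt)).

Lemma enc_num_automaton B : enc (num_automaton B) = code_automaton B.
Proof.
rewrite /code_automaton /code_list /= -map_comp; congr (CodeSeq.code [:: _; CodeSeq.code _]).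
by apply: eq_map => row /=; rewrite -map_comp.
Qed.

Definition state := {i : 'I_m & 'I_(aut_size (tnth A i))}.
Implicit Types (qs : seq state) (v : seq 'I_d) (c : 'I_d).

Definition num_state (s : state) : seq nat := [:: nat_of_ord (tag s); nat_of_ord (tagged s)].

(** The output letter of each automaton is the input of the next, the leftmost acting first, as in
    the right action. *)
Fixpoint product_step qs c : 'I_d * seq state :=
  if qs is s :: qs' then
    let p := aut_delta (tnth A (tag s)) (tagged s) c in
    let r := product_step qs' p.1 in (r.1, Tagged _ p.2 :: r.2)
  else (c, [::]).

Definition product_next qs v := foldl (fun qs c => (product_step qs c).2) qs v.

Definition product_run qs v :=
  foldl (fun v (s : state) => aut_run (A := tnth A (tag s)) (tagged s) v) v qs.

Lemma product_run_nil qs : product_run qs [::] = [::].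
Proof. by rewrite /product_run; elim: qs. Qed.

(** This exchanges two orders of processing: the whole word through one automaton after another, or
    each letter through all automata in turn. *)
Lemma product_run_cons qs c v :
  product_run qs (c :: v) =
  (product_step qs c).1 :: product_run (product_step qs c).2 v.
Proof. by rewrite /product_run; elim: qs c v => //= s qs IH c v; rewrite IH. Qed.

Lemma product_run_cat qs u v :
  product_run qs (u ++ v) = product_run qs u ++ product_run (product_next qs u) v.
Proof.
elim: u qs => [|c u IH] qs; first by rewrite product_run_nil.
by rewrite cat_cons !product_run_cons IH.
Qed.

Let As := map num_automaton A.

Lemma nth_As (i : 'I_m) : nth (0, ([::], tt)) As i = num_automaton (tnth A i).
Proof.
by rewrite (nth_map (tnth A i)) ?size_tuple// -tnth_nth.
Qed.

Lemma ntransE s c : ntrans As (num_state s) c =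
  let p := aut_delta (tnth A (tag s)) (tagged s) c in [:: nat_of_ord p.1; nat_of_ord p.2].
Proof. by rewrite /ntrans /= nth_As !nth_map_codom. Qed.

Lemma nstepE qs c : nstep As c (map num_state qs) =
  (nat_of_ord (product_step qs c).1, map num_state (product_step qs c).2).
Proof.
rewrite /nstep -[map num_state (product_step qs c).2]cat0s.
set F := (F in foldl F); elim: qs c [::] => [|s qs IH] c r; first by rewrite cats0.
have Fs : F (nat_of_ord c, r) (num_state s) =
    (let p := aut_delta (tnth A (tag s)) (tagged s) c in
     (nat_of_ord p.1, rcons r (num_state (Tagged (fun i => 'I_(aut_size (tnth A i))) p.2)))).
  by rewrite /F ntransE.
by rewrite /= Fs IH cat_rcons.
Qed.

Lemma nrunE qs v : nrun As (map num_state qs) (map val v) =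
  (product_run qs v == v, map num_state (product_next qs v)).
Proof.
rewrite /nrun -[product_run qs v == v]andTb.
elim: v true qs => [|c v IH] b qs /=; first by rewrite product_run_nil andbT.
by rewrite nstepE IH product_run_cons eqseq_cons andbA.
Qed.

Definition initial_state (i : 'I_m) : state := Tagged _ (aut_init (tnth A i)).

Lemma ninitE (w : seq 'I_m) :
  ninit As (map val w) = map num_state (map initial_state w).
Proof.
rewrite /ninit -[RHS]cat0s; set F := (F in foldl F).
elim: w [::] => [|i w IH] r /=; first by rewrite cats0.
by rewrite IH /F nth_As cat_rcons.
Qed.

Lemma product_run_presents (x : 'I_m -> taut d) (w : seq 'I_m) v :
  (forall i, presents (tnth A i) (x i)) ->
  product_run (map initial_state w) v = (\big[*%g/1%g]_(g <- map x w) g)%g v.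
Proof.
move=> xP; rewrite /product_run; elim: w v => [|i w IH] v; first by rewrite big_nil.
rewrite map_cons big_cons [LHS]/= -(xP i v).
exact: IH.
Qed.

(** Induction on [v] with [qs] varying: each letter is fixed, and the next state vector stays in
    [L]. *)
Lemma nclosed_fixes L qs v : nclosed d As L -> map num_state qs \in L ->
  product_run qs v = v.
Proof.
move=> /allP clL; elim: v qs => [|c v IH] qs Lqs; first exact: product_run_nil.
have /allP/(_ (nat_of_ord c)) := clL _ Lqs; rewrite mem_letters ltn_ord => /(_ isT).
by rewrite nstepE /= => /andP[/eqP/val_inj e1 /IH e2]; rewrite product_run_cons e1 e2.
Qed.

Lemma size_product_step qs c : size (product_step qs c).2 = size qs.
Proof. by elim: qs c => //= s qs IH c; rewrite IH. Qed.

(* The list of all state vectors acting trivially is a closed certificate. *)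
Lemma nclosed_exists qs : (forall v, product_run qs v = v) ->
  exists2 L, nclosed d As L & map num_state qs \in L.
Proof.
move=> idqs.
(* A step preserves the length of a state vector, so it suffices to enumerate the finite type of
   vectors of length [size qs]. *)
pose triv (t : (size qs).-tuple state) := `[< forall v, product_run t v = v >].
exists [seq map num_state (val t) | t <- enum triv]; last first.
  apply/mapP; exists (in_tuple qs) => //.
  by rewrite mem_enum; apply/asboolP.
apply/allP => q /mapP[t]; rewrite mem_enum => /asboolP idt ->{q}.
apply/allP => c; rewrite mem_letters => lt_c.
have := nstepE t (Ordinal lt_c); rewrite [nat_of_ord (Ordinal lt_c)]/= => ->.
(* Triviality on the word extended by a first letter gives both that this letter is fixed and that
   the next vector acts trivially. *)
have stepP v : (product_step t (Ordinal lt_c)).1 = Ordinal lt_c /\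
    product_run (product_step t (Ordinal lt_c)).2 v = v.
  by have := idt (Ordinal lt_c :: v); rewrite product_run_cons => -[].
rewrite /= (stepP [::]).1 eqxx /=.
have sz : size (product_step t (Ordinal lt_c)).2 == size qs.
  by rewrite size_product_step size_tuple.
apply/mapP; exists (Tuple sz) => //.
by rewrite mem_enum; apply/asboolP => v; have [] := stepP v.
Qed.

End ProductAutomaton.

(** * The decision procedure *)

Lemma taut_fix_prefix d (a : taut d) u v : a (u ++ v) = u ++ v -> a u = u.
Proof. by rewrite sectionE => /eqP; rewrite eqseq_cat ?size_taut// => /andP[/eqP]. Qed.

Lemma generated_prod d (X : set (taut d)) (gs : seq (taut d)) :
  (forall g, g \in gs -> X g) -> generated X (\big[*%g/1%g]_(g <- gs) g)%g.
Proof.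
move=> Xgs H [[H1 HM _] XH]; rewrite big_seq.
by apply: big_ind => // g /Xgs; exact: XH.
Qed.

Lemma enc_certificate_surj n : exists y : ncertificate, enc y = n.
Proof. by move: n; do 4!apply: enc_seq_surj; move=> n; exists n. Qed.

Definition num_instance d m (A : m.-tuple (automaton d)) (w : seq 'I_m) (T : tm d) : ninstance :=
  (d, (map (@num_automaton d) A, (map val w, (num_tm T, tt)))).

Lemma enc_num_instance d m (A : m.-tuple (automaton d)) w T :
  enc (num_instance A w T) = code_instance A w T.
Proof.
rewrite /code_instance /code_list -enc_num_tm.
(* Both sides become nested [cons_code]; the final [0] is the code of [tt] as well as of the empty
   list. *)
change (cons_code d (cons_code (CodeSeq.code (map enc (map (@num_automaton d) A)))
  (cons_code (enc (map val w)) (cons_code (enc (num_tm T)) 0))) =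
  cons_code d (cons_code (CodeSeq.code (map (@code_automaton d) A))
  (cons_code (CodeSeq.code (map val w)) (cons_code (enc (num_tm T)) 0)))).
rewrite enc_nat_seq -map_comp; congr (cons_code _ (cons_code (CodeSeq.code _) _)).
apply: eq_map => B; exact: enc_num_automaton.
Qed.

Local Open Scope classical_set_scope.

Theorem proposition2p10 :
  exists D : recfun 1,
    forall (d : nat) (hd : 2 <= d)
      (m : nat) (x : 'I_m -> taut d) (A : m.-tuple (automaton d))
      (w : seq 'I_m) (T : tm d) (eta : ray d),
      (forall i, bounded_automaton_aut (x i)) ->
      (forall i, presents (tnth A i) (x i)) ->
      symmetric_set (range x) ->
      tm_outputs T eta ->
      ~ eventually_periodic eta ->
      answers D (code_instance A w T)
        (WP (range x) (Stab (range x) eta) [seq x i | i <- w]).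
Proof.
(* This is the disjunction of [moves] and [fixes], written with connectives already known to be
   computable. *)
have cP : computable (fun p => ~~ (~~ moves p && ~~ fixes p)).
  apply/computable_negb/computable_andb/computable_negb/computable_fixes.
  exact/computable_negb/computable_moves.
(* The search stops at a certificate of either kind and outputs whether it is of the kind
   [fixes]. *)
have [D DP] := computable_search enc_certificate_surj cP computable_fixes.
exists D => d _ m x A w T eta bx xA _ Teta per.
set g := (\big[*%g/1%g]_(g <- [seq x i | i <- w]) g)%g.
pose qs := map (initial_state A) w; pose I := num_instance A w T.
pose out t := cfg_out (iter t (@tm_step d T) (tm_init T)).
have gE v : product_run qs v = g v by exact: product_run_presents.
have outE t : out t = mkseq eta (size (out t)) by exact: tm_outputs_mkseq.
have runE y : cert_run (I, y) = (g (out (size (behead y))) == out (size (behead y)),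
    map (@num_state d m A) (product_next qs (out (size (behead y))))).
  by rewrite /cert_run /I /= ninitE ntm_outE nrunE -/qs gE.
have WPE : WP (range x) (Stab (range x) eta) [seq x i | i <- w] <->
    forall n, g (mkseq eta n) = mkseq eta n.
  have inX h : h \in [seq x i | i <- w] -> range x h by case/mapP => i _ ->; exists i.
  split=> [[_ [_ /ray_act_fix//]]|fix_eta].
  by split=> //; split; [exact: generated_prod|exact/ray_act_fix].
have moves_not_WP y : moves (I, y) -> ~ forall n, g (mkseq eta n) = mkseq eta n.
  by rewrite /moves runE /= outE => /eqP + fix_eta; apply.
have fixes_WP y : fixes (I, y) -> forall n, g (mkseq eta n) = mkseq eta n.
  rewrite /fixes runE => /and3P[/eqP g_out inL clL] n.
  set o := out _ in g_out inL.
  (* The section at [o] controls only prefixes extending [o]; the prefix of length [n] is an initial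
     part of such a one. *)
  suff: g (mkseq eta (size o + n)) = mkseq eta (size o + n).
    by rewrite addnC mkseq_add; exact: taut_fix_prefix.
  by rewrite mkseq_add -outE -gE product_run_cat (nclosed_fixes _ clL inL) gE g_out.
have cert_exists : exists y, ~~ (~~ moves (I, y) && ~~ fixes (I, y)).
  have [fix_eta|/existsNP[n not_fix]] := pselect (forall n, g (mkseq eta n) = mkseq eta n).
    have bg : bounded_automaton_aut g.
      by apply: bounded_automaton_prod => _ /mapP[i _ ->].
    (* The promise enters here, excluding a ray along which every section of [g] is nontrivial. *)
    have [n gn] : exists n, section g (mkseq eta n) = 1%g.
      apply: contrapT => /forallNP nt; apply: per.
      by apply: (nontrivial_sections_periodic bg) => n; apply/eqP/nt.
    have [t nt] := tm_outputs_size n Teta.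
    (* The output may overshoot level [n], but sections of the identity are trivial. *)
    have secg : section g (out t) = 1%g.
      by rewrite outE -(subnKC nt) mkseq_add section_cat gn section_one.
    have [|L clL inL] := nclosed_exists (qs := product_next qs (out t)).
      move=> v; have := gE (out t ++ v); rewrite product_run_cat gE sectionE secg.
      by move/eqP; rewrite eqseq_cat// => /andP[_ /eqP].
    (* The [t] empty entries encode the number of machine steps. *)
    exists (L :: nseq t [::]); rewrite negb_and !negbK /fixes runE /= size_nseq inL clL.
    by rewrite outE fix_eta eqxx orbT.
  have [t nt] := tm_outputs_size n Teta.
  exists ([::] :: nseq t [::]); rewrite negb_and !negbK /moves runE /= size_nseq.
  (* Fixing the longer output would fix its prefix of length [n], which [g] moves. *)
  apply/orP; left; apply/eqP => g_out; apply: not_fix.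
  by move: g_out; rewrite outE -(subnKC nt) mkseq_add; exact: taut_fix_prefix.
have [y [Py]] := DP I cert_exists; rewrite enc_num_instance => Dy.
(* A certificate of the kind [moves] refutes membership and one of the kind [fixes] proves it, so
   the kind of the certificate found settles the question. *)
have fixE : fixes (I, y) <-> WP (range x) (Stab (range x) eta) [seq x i | i <- w].
  rewrite WPE; split=> [/fixes_WP //|fix_eta]; move: Py; rewrite negb_and !negbK.
  by case/orP => // /moves_not_WP.
by split=> [/fixE e|/fixE/negP/negPf e]; move: Dy; rewrite e.
Qed.
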